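(* Let $\Gamma$ be a finite connected bipartite graph with ordered bipartition $(B|B')$, let $G\leq\mathrm{Aut}(\Gamma)$, let $1\neq N\lhd G$, and let $r\geq3$ be an integer. Suppose that: (i) $\Gamma$ is $r$-starlike relative to $N$, and $\Gamma$ is locally $(G,4)$-distance transitive; (ii) the adjacency design $\mathcal{D}(\Gamma)$ is $G$-pairwise transitive and $N$-nicely affine with $r$ parallel classes of blocks. If $N$ is regular on $B$, then $N$ is elementary abelian and $\Gamma$, $\mathcal{D}(\Gamma)$ can be obtained (up to isomorphism) from the vector space construction described in the context.
   Context: All graphs are finite, simple and without loops. The vector space construction. Let $V=V(d,p)$ be a vector space of dimension $d$ over the field with $p$ elements, $p$ prime, with group of translations $\hat N$, and let $\hat G=\hat N.\hat G_0\leq\mathrm{AGL}(d,p)$ with $\hat G_0\leq\mathrm{GL}(d,p)$, such that: (a) $\hat G^V$ has rank $2$ or $3$; (b) there exists a $\hat G_0$-orbit $\mathcal{M}=\{M_1,\ldots,M_r\}$ ($r\geq3$) of subspaces of $V$ such that $\hat G_0^{\mathcal{M}}$ is $2$-transitive (not necessarily faithful); (c) $V=M_1+M_2$; (d) the stabiliser $(\hat G_0)_{M_1}$ acts transitively on $(V/M_1)^*=\{v+M_1\mid v\in V\setminus M_1\}$; (e) $\bigcup_{i=1}^r M_i^*$ is a $\hat G_0$-orbit, where $M_i^*=M_i\setminus\{0\}$. The construction produces the design $(V,\bigcup_{i=1}^r V/M_i,\mathcal{I})$ with point set $V$, blocks all cosets of the $M_i$, and incidence given by inclusion, and its incidence graph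 (the bipartite graph with ordered bipartition (points | blocks) and adjacency given by incidence). $\hat G^X$ denotes the permutation group induced on $X$. The rank of a transitive permutation group is the number of orbits of a point stabiliser. A group is regular on a set if it is transitive and only the identity fixes an element of the set. Locally $(G,s)$-distance transitive: the graph has diameter at least $s$, $G$ is a subgroup of its automorphism group, and for each vertex $v$ and each $1\leq i\leq s$ the stabiliser $G_v$ is transitive on the set of vertices at distance $i$ from $v$. $r$-starlike: a connected bipartite graph with ordered bipartition $(B|B')$ is $r$-starlike relative to $N$ if $N\leq\mathrm{Aut}(\Gamma)$, $r\geq2$, $N$ is transitive on $B$, and $N$ has exactly $r$ orbits on $B'$. A design $(\mathcal{P},\mathcal{B},\mathcal{I})$ consists of a point set, a block set and an incidence relation $\mathcal{I}\subseteq\mathcal{P}\times\mathcal{B}$; automorphisms are permutations of $\mathcal{P}\cup\mathcal{B}$ preserving points, blocks and incidence. Two distinct points are collinear if incident with at least one common block, otherwise non-collinear; two distinct blocks are intersecting if incident with at least one common point, otherwise non-intersecting. The adjacency design $\mathcal{D}(\Gamma)$ has point set $B$, block set $B'$ and incidence given by adjacency in $\Gamma$. $G$-pairwise transitive: $G$ is a group of automorphisms transitive on each of the following six (possibly empty) sets: incident and non-incident point-block pairs, collinear and non-collinear point pairs, intersecting and non-intersecting block pairs (ordered pairs of distinct elements). $N$-nicely affine: $N$ is a group of automorphisms transitive on points, and there is a constant $\mu$ such that distinct blocks are incident with exactly $\mu$ common points if they are in different $N$-orbits and with no common point if they are in the same $N$-orbit. The $N$-orbits on blocks are the parallel classes.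 *)

(* Defs.v *)
From mathcomp Require Import all_boot all_order all_algebra all_fingroup all_solvable.

Set Implicit Arguments.
Unset Strict Implicit.
Unset Printing Implicit Defensive.

Import GRing.Theory.
Local Open Scope group_scope.

Record sgraph := SGraph {
  vertex :> finType;
  adj : rel vertex;
  adj_sym : symmetric adj;
  adj_irrefl : irreflexive adj }.

Record bigraph := BiGraph {
  bi_graph :> sgraph;
  part1 : {set bi_graph};
  part2 : {set bi_graph};
  part_cover : part1 :|: part2 = [set: bi_graph];
  part_disjoint : [disjoint part1 & part2];
  adj_part : forall x y : bi_graph, adj x y ->
    ((x \in part1) && (y \in part2)) || ((x \in part2) && (y \in part1)) }.

Section Graphs.
Variable X : sgraph.

Definition graph_aut : {set {perm X}} :=
  [set g : {perm X} | [forall x, forall y, adj (g x) (g y) == adj x y]].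

Definition connected_graph : Prop := forall x y : X, connect (@adj X) x y.

Definition walk (n : nat) (x y : X) : bool :=
  [exists t : n.-tuple X, path (@adj X) x t && (last x t == y)].

(* Takes the junk value #|X| when x and y are not connected; two connected
   vertices are at distance less than #|X|. *)
Definition dist (x y : X) : nat :=
  find (fun n => walk n x y) (iota 0 #|X|).

Definition diameter : nat := \max_(x : X) \max_(y : X) dist x y.

Definition sphere (x : X) (i : nat) : {set X} := [set y | dist x y == i].

(* The spheres may be empty, which is why [transitive _, on _ | _], false on
   the empty set, is not used. *)
Definition locally_distance_transitive (G : {group {perm X}}) (s : nat) : Prop :=
  [/\ s <= diameter, G \subset graph_aut &
      forall (x : X) (i : nat), 1 <= i <= s ->
        {in sphere x i &, forall y z, z \in orbit 'P 'C_G[x | 'P] y}].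

End Graphs.

Definition starlike (X : bigraph) (N : {group {perm X}}) (r : nat) : Prop :=
  [/\ connected_graph X, N \subset graph_aut X, 2 <= r,
      [transitive N, on part1 X | 'P] &
      #|orbit 'P N @: part2 X| = r].

Definition bigraph_iso (X Y : bigraph) : Prop :=
  exists f : X -> Y,
    [/\ bijective f,
        forall x, (f x \in part1 Y) = (x \in part1 X),
        forall x, (f x \in part2 Y) = (x \in part2 X) &
        forall x y, adj (f x) (f y) = adj x y].

Definition regular_on (T : finType) (N : {group {perm T}}) (S : {set T}) : Prop :=
  [transitive N, on S | 'P] /\ {in S, forall x, 'C_N[x | 'P] = 1}.

(* [elem] is the disjoint union of the point set and the block set, so that
   automorphisms are permutations of [elem]. *)
Record design := Design {
  elem : finType;
  points : {set elem};
  blocks : {set elem};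
  incident : rel elem;
  design_cover : points :|: blocks = [set: elem];
  design_disjoint : [disjoint points & blocks];
  incident_pb : forall x y, incident x y -> (x \in points) && (y \in blocks) }.

Section Designs.
Variable D : design.

Definition design_aut : {set {perm elem D}} :=
  [set g : {perm elem D} |
    [&& [forall x, (g x \in points D) == (x \in points D)],
        [forall x, (g x \in blocks D) == (x \in blocks D)] &
        [forall x, forall y, incident (g x) (g y) == incident x y]]].

Definition non_incident (x b : elem D) : bool :=
  [&& x \in points D, b \in blocks D & ~~ incident x b].

Definition collinear (x y : elem D) : bool :=
  [&& x \in points D, y \in points D, x != y &
      [exists b, incident x b && incident y b]].

Definition non_collinear (x y : elem D) : bool :=
  [&& x \in points D, y \in points D, x != y &
      ~~ [exists b, incident x b && incident y b]].

Definition common_points (b c : elem D) : {set elem D} :=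
  [set x | incident x b && incident x c].

Definition intersecting (b c : elem D) : bool :=
  [&& b \in blocks D, c \in blocks D, b != c & common_points b c != set0].

Definition non_intersecting (b c : elem D) : bool :=
  [&& b \in blocks D, c \in blocks D, b != c & common_points b c == set0].

Definition transitive_on_pairs (G : {group {perm elem D}}) (R : rel (elem D)) :
    Prop :=
  forall x y x' y', R x y -> R x' y' ->
    exists g : {perm elem D}, [/\ g \in G, g x = x' & g y = y'].

Definition pairwise_transitive (G : {group {perm elem D}}) : Prop :=
  [/\ G \subset design_aut,
      transitive_on_pairs G (@incident D) /\ transitive_on_pairs G non_incident,
      transitive_on_pairs G collinear /\ transitive_on_pairs G non_collinear &
      transitive_on_pairs G intersecting /\
      transitive_on_pairs G non_intersecting].

Definition parallel_classes (N : {group {perm elem D}}) : {set {set elem D}} :=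
  orbit 'P N @: blocks D.

Definition nicely_affine (N : {group {perm elem D}}) : Prop :=
  [/\ N \subset design_aut, [transitive N, on points D | 'P] &
      exists mu : nat, {in blocks D &, forall b c, b != c ->
        #|common_points b c| = if c \in orbit 'P N b then 0%N else mu}].

End Designs.

Definition design_iso (D E : design) : Prop :=
  exists f : elem D -> elem E,
    [/\ bijective f,
        forall x, (f x \in points E) = (x \in points D),
        forall x, (f x \in blocks E) = (x \in blocks D) &
        forall x y, incident (f x) (f y) = incident x y].

Section AdjacencyDesign.
Variable X : bigraph.

Definition adj_incident (x y : X) : bool := (x \in part1 X) && adj x y.

Lemma adj_incident_pb x y :
  adj_incident x y -> (x \in part1 X) && (y \in part2 X).
Proof.
case/andP=> x1 /adj_part/orP[] // /andP[x2 _].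
by move: (part_disjoint X) => /disjointFr/(_ x1); rewrite x2.
Qed.

Definition adjacency_design : design :=
  @Design (vertex X) (part1 X) (part2 X) adj_incident
    (part_cover X) (part_disjoint X) adj_incident_pb.

End AdjacencyDesign.

Section IncidenceGraph.
Variable D : design.

Definition inc_adj : rel (elem D) := fun x y => incident x y || incident y x.

Lemma inc_adj_sym : symmetric inc_adj.
Proof. by move=> x y; rewrite /inc_adj orbC. Qed.

Lemma inc_adj_irrefl : irreflexive inc_adj.
Proof.
move=> x; apply/negP; rewrite /inc_adj orbb => /incident_pb/andP[xP xB].
by move: (design_disjoint D) => /disjointFr/(_ xP); rewrite xB.
Qed.

Lemma inc_adj_part x y : inc_adj x y ->
  ((x \in points D) && (y \in blocks D)) || ((x \in blocks D) && (y \in points D)).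
Proof. by case/orP=> /incident_pb/andP[-> ->]; rewrite ?orbT. Qed.

Definition incidence_graph : bigraph :=
  @BiGraph (SGraph inc_adj_sym inc_adj_irrefl) (points D) (blocks D)
    (design_cover D) (design_disjoint D) inc_adj_part.

End IncidenceGraph.

Definition has_rank (T : finType) (G : {group {perm T}}) (n : nat) : Prop :=
  [transitive G, on [set: T] | 'P] /\
  forall x : T, #|orbit 'P 'C_G[x | 'P] @: [set: T]| = n.

Section VectorSpace.
Variables p d : nat.
Local Notation V := 'rV['F_p]_d.

Definition translation (b : V) : {perm V} := perm (@addIr V b).

Definition translations : {set {perm V}} := [set translation b | b : V].

(* GL(d,p) as a permutation group of V, matrices acting on row vectors. *)
Definition linear_perms : {set {perm V}} :=
  [set g : {perm V} | [exists A : 'M['F_p]_d,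
     (A \in unitmx) && [forall v : V, g v == v *m A]%R]].

Definition is_subspace (M : {set V}) : Prop :=
  exists U : {vspace V}, M = [set v | v \in U].

Definition coset_by (M : {set V}) (v : V) : {set V} :=
  [set (v + m)%R | m in M].

Definition cosets (M : {set V}) : {set {set V}} := coset_by M @: [set: V].

Definition nonzero_cosets (M : {set V}) : {set {set V}} := coset_by M @: ~: M.

(* Subspaces are represented by their sets of vectors, permuted by 'P^*;
   M1 and M2 are the two members of Ms which are so labelled in V = M1 + M2. *)
Record vs_conditions (r : nat) (Ghat G0 : {group {perm V}})
    (Ms : {set {set V}}) (M1 M2 : {set V}) : Prop := VSConditions {
  vs_prime : prime p;
  vs_linear : G0 \subset linear_perms;
  vs_group : Ghat = translations * G0 :> {set {perm V}};
  vs_rank : has_rank Ghat 2 \/ has_rank Ghat 3;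
  vs_subspace : {in Ms, forall M, is_subspace M};
  vs_card : 3 <= r /\ #|Ms| = r;
  vs_M1 : M1 \in Ms;
  vs_M2 : M2 \in Ms;
  vs_M12 : M1 != M2;
  vs_orbit : Ms = orbit 'P^* G0 M1;
  vs_2trans : [transitive^2 G0, on Ms | 'P^*];
  vs_sum : [set (u + v)%R | u in M1, v in M2] = [set: V];
  vs_quotient :
    [transitive 'C_G0[M1 | 'P^*], on nonzero_cosets M1 | 'P^*];
  vs_union :
    exists v : V, \bigcup_(M in Ms) (M :\ 0%R) = orbit 'P G0 v }.

Section Design.
Variable Ms : {set {set V}}.

Definition vs_blocks : {set {set V}} := \bigcup_(M in Ms) cosets M.

Definition vs_elem : finType := (V + {b : {set V} | b \in vs_blocks})%type.

Definition vs_points : {set vs_elem} := [set x | if x is inl _ then true else false].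

Definition vs_block_elems : {set vs_elem} := ~: vs_points.

Definition vs_incident : rel vs_elem := fun x y =>
  match x, y with inl v, inr b => v \in val b | _, _ => false end.

Lemma vs_incident_pb x y :
  vs_incident x y -> (x \in vs_points) && (y \in vs_block_elems).
Proof. by case: x y => [v|b] [w|c] //= _; rewrite !inE. Qed.

Lemma vs_cover : vs_points :|: vs_block_elems = [set: vs_elem].
Proof. exact: setUCr. Qed.

Lemma vs_disjoint : [disjoint vs_points & vs_block_elems].
Proof. by rewrite -setI_eq0 setICr. Qed.

Definition vs_design : design := Design vs_cover vs_disjoint vs_incident_pb.

End Design.
End VectorSpace.

Definition from_vs_construction (X : bigraph) (D : design) (r : nat) : Prop :=
  exists (p d : nat) (Ghat G0 : {group {perm 'rV['F_p]_d}})
         (Ms : {set {set 'rV['F_p]_d}}) (M1 M2 : {set 'rV['F_p]_d}),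
    [/\ vs_conditions r Ghat G0 Ms M1 M2,
        bigraph_iso X (incidence_graph (vs_design Ms)) &
        design_iso D (vs_design Ms)].

(* Main.v *)
(* Identify the point set with [N] through a base point [x0]. The blocks through
   [x0] become the [r] subgroups [M] of [N] stabilising them, all blocks become
   cosets of these, and [G_x0] acts on [N] by conjugation. Two blocks in
   different classes meet, so [N = M L] for [M != L]; pairwise transitivity makes
   [G_x0] 2-transitive on the subgroups [M], transitive on the nontrivial
   elements of their union and on the complement of the union in [N], and makes
   the stabiliser of [M] transitive on the nontrivial double cosets of [M]; here
   [M != N] because a complete bipartite graph has diameter 2. Hence the
   nontrivial elements of the subgroups [M] all have the same prime order [p],
   [N = M L] is a p-group, and it turns out to be abelian, so that it is the
   required vector space, with [G_x0] acting linearly. *)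
Require Import Defs.
From mathcomp Require Import all_boot all_order all_algebra all_fingroup all_solvable.
From mathcomp Require Import mxrepresentation mxabelem.

Set Implicit Arguments.
Unset Strict Implicit.
Unset Printing Implicit Defensive.

(** * Families of subgroups in which any two members factorise the group *)

Section SubgroupFamily.
Local Open Scope group_scope.
Variable gT : finGroupType.

(* [sf_quot] speaks of double cosets of [M] because [N] is not known to be
   abelian at this point. *)
Record subgroup_family (N H : {group gT}) (Ms : {set {group gT}}) : Prop :=
  SubgroupFamily {
  sf_norm : H \subset 'N(N);
  sf_card : 1 < #|Ms|;
  sf_proper : {in Ms, forall M : {group gT}, M \proper N};
  sf_mul : {in Ms &, forall M L : {group gT}, M != L -> M * L = N};
  sf_stable : {in Ms & H, forall (M : {group gT}) h, (M :^ h)%G \in Ms};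
  sf_2trans : forall M L M' L' : {group gT}, M \in Ms -> L \in Ms -> M' \in Ms ->
    L' \in Ms -> M != L -> M' != L' ->
    exists h, [/\ h \in H, (M :^ h)%G = M' & (L :^ h)%G = L'];
  sf_union : {in \bigcup_(M in Ms) M^# &, forall x y,
    exists2 h, h \in H & y = x ^ h};
  sf_compl : {in N :\: \bigcup_(M in Ms) M &, forall x y,
    exists2 h, h \in H & y = x ^ h};
  sf_quot : {in Ms, forall M : {group gT}, {in N :\: M &, forall x y,
    exists h, [/\ h \in H, (M :^ h)%G = M & y \in M * (x ^ h *: M)]}} }.

Variables (N H : {group gT}) (Ms : {set {group gT}}).
Hypothesis fam : subgroup_family N H Ms.

Lemma sf_other M : M \in Ms -> exists2 L, L \in Ms & M != L.
Proof.
move=> MMs; have := sf_card fam; rewrite (cardsD1 M) MMs ltnS.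
case/card_gt0P=> L; rewrite !inE => /andP[neLM LMs].
by exists L; rewrite // eq_sym.
Qed.

Lemma sf_sub M : M \in Ms -> M \subset N.
Proof. by move=> MMs; apply: proper_sub; apply: (sf_proper fam). Qed.

(** By [sf_union] a single nontrivial element of one member has all the others as [H]-conjugates, so
    [K] contains every member and hence a product [M * L = N]. This is applied to the centre and to
    the derived subgroup of [N]. *)
Lemma sf_absorb (K : {group gT}) x M : H \subset 'N(K) ->
  M \in Ms -> x \in M^# -> x \in K -> N \subset K.
Proof.
move=> nKH MMs Mx Kx.
have sMK L : L \in Ms -> L \subset K.
  move=> LMs; apply/subsetP=> y Ly; have [-> //|nty] := eqVneq y 1.
  have [||h Hh ->] := sf_union fam (x := x) (y := y).
  - by apply/bigcupP; exists M.
  - by apply/bigcupP; exists L; rewrite // !inE nty.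
  by rewrite memJ_norm // (subsetP nKH).
have [L LMs neML] := sf_other MMs.
by rewrite -(sf_mul fam MMs LMs neML) mul_subG ?sMK.
Qed.

(** If [M] were trivial, [M * L = N] would force [L = N], although [L] is proper. *)
Lemma sf_nontrivial M : M \in Ms -> M :!=: 1.
Proof.
move=> MMs; have [L LMs neML] := sf_other MMs.
apply/eqP=> M1; have := sf_proper fam LMs.
by rewrite -(sf_mul fam MMs LMs neML) M1 mul1g properxx.
Qed.

(** Cauchy's theorem gives an element of prime order in one member; by [sf_union] all nontrivial
    elements of all members are conjugate to it. *)
Lemma sf_order : exists2 p, prime p &
  {in Ms, forall M : {group gT}, {in M, forall x, x ^+ p = 1}}.
Proof.
have /card_gt0P[M MMs] : 0 < #|Ms| by rewrite ltnW ?(sf_card fam).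
have ntM := sf_nontrivial MMs.
have p_pr : prime (pdiv #|M|) by rewrite pdiv_prime ?cardG_gt1.
have [x Mx ox] := Cauchy p_pr (pdiv_dvd _).
exists (pdiv #|M|) => // L LMs y Ly.
have [-> |nty] := eqVneq y 1; first exact: expg1n.
have [||h Hh ->] := sf_union fam (x := x) (y := y).
- apply/bigcupP; exists M; rewrite // !inE Mx andbT.
  by rewrite -order_gt1 ox prime_gt1.
- by apply/bigcupP; exists L; rewrite // !inE nty.
by rewrite -conjXg -ox expg_order conj1g.
Qed.

Lemma sf_pgroup p : prime p ->
  {in Ms, forall M : {group gT}, {in M, forall x, x ^+ p = 1}} -> p.-group N.
Proof.
move=> p_pr expMs.
have pM M : M \in Ms -> p.-group M.
  move=> MMs; apply/pgroupP=> q q_pr /(Cauchy q_pr)[x Mx ox].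
  rewrite inE /= -(dvdn_prime2 q_pr p_pr) -ox order_dvdn.
  by rewrite (expMs M).
have /card_gt0P[M MMs] : 0 < #|Ms| by rewrite ltnW ?(sf_card fam).
have [L LMs neML] := sf_other MMs.
by rewrite -(sf_mul fam MMs LMs neML) pgroupM !pM.
Qed.

Lemma sf_ntN : N :!=: 1.
Proof.
have /card_gt0P[M MMs] : 0 < #|Ms| by rewrite ltnW ?(sf_card fam).
by apply: contraNneq (sf_nontrivial MMs) => N1; rewrite -subG1 -N1 sf_sub.
Qed.

(* Otherwise the centre and the derived subgroup of the p-group [N] avoid the
   nontrivial elements of [M]. A central [z != 1] then lies outside [M], and
   transitivity on the nontrivial double cosets of [M] gives [N = M Z(N)],
   whence [M] is normal and contains [N^`(1)]. *)
Lemma sf_abelian : abelian N.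
Proof.
have [p p_pr expMs] := sf_order; have pN := sf_pgroup p_pr expMs.
have ntZ : 'Z(N) != 1.
  by apply: contraNneq sf_ntN => /(trivg_center_pgroup pN) ->.
have nNH := sf_norm fam.
have nZH : H \subset 'N('Z(N)) := char_norm_trans (center_char _) nNH.
have nDH : H \subset 'N(N^`(1)) := char_norm_trans (der_char _ _) nNH.
have [z Zz ntz] := trivgPn _ ntZ.
have /card_gt0P[M MMs] : 0 < #|Ms| by rewrite ltnW ?(sf_card fam).
have [Mz|nMz] := boolP (z \in M).
  have sNZ : N \subset 'Z(N) by apply: sf_absorb nZH MMs _ Zz; rewrite !inE ntz.
  exact: subset_trans sNZ (subsetIr _ _).
have defN : N \subset M * 'Z(N).
  apply/subsetP=> y Ny; have [My|nMy] := boolP (y \in M).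
    by rewrite -[y]mulg1 mem_mulg.
  have NMz : z \in N :\: M by rewrite inE nMz (subsetP (center_sub _) z Zz).
  have NMy : y \in N :\: M by rewrite inE nMy.
  have [h [Hh _]] := sf_quot fam MMs NMz NMy.
  case/mulsgP=> m1 w Mm1 /lcosetP[m2 Mm2 ->] ->.
  have Zzh : z ^ h \in 'Z(N) by rewrite memJ_norm // (subsetP nZH).
  have /centerP[_ cz] := Zzh.
  have -> : z ^ h * m2 = m2 * z ^ h by apply: cz; apply: (subsetP (sf_sub MMs)).
  rewrite mulgA; apply: mem_mulg; [exact: groupM | exact: Zzh].
have nsMN : M <| N.
  rewrite /normal sf_sub //; apply: subset_trans defN _.
  rewrite mul_subG ?normG // cents_norm // (subset_trans (subsetIr _ _)) //.
  by rewrite centS ?sf_sub.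
have sDM : N^`(1) \subset M.
  rewrite der1_min ?normal_norm //.
  have: N / M \subset 'Z(N) / M.
    by apply: subset_trans (quotientS M defN) _; rewrite quotientMidl.
  move/abelianS; apply; exact/quotient_abelian/center_abelian.
have [/eqP D1 | /trivgPn[x Dx ntx]] := boolP (N^`(1) == 1).
  by apply/commG1P; rewrite -derg1.
have sND : N \subset N^`(1).
  by apply: sf_absorb nDH MMs _ (Dx); rewrite !inE ntx (subsetP sDM).
have /properP[_ [y Ny []]] := sf_proper fam MMs.
by rewrite (subsetP sDM) ?(subsetP sND).
Qed.

(** Once [N] is abelian, the exponent [p] passes from two members to their product [N]. *)
Lemma sf_abelem : is_abelem N.
Proof.
have [p p_pr expMs] := sf_order; have pN := sf_pgroup p_pr expMs.
apply/is_abelemP; exists p => //; apply/abelemP=> //; split=> [|x].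
  exact: sf_abelian.
have /card_gt0P[M MMs] : 0 < #|Ms| by rewrite ltnW ?(sf_card fam).
have [L LMs neML] := sf_other MMs.
rewrite -(sf_mul fam MMs LMs neML) => /mulsgP[y z My Lz ->].
have cyz : commute y z.
  by apply: (centsP sf_abelian); rewrite ?(subsetP (sf_sub _) y My)
    ?(subsetP (sf_sub _) z Lz).
by rewrite expgMn // (expMs M) // (expMs L) // mulg1.
Qed.

End SubgroupFamily.

(** * Translations, linear permutations and subspaces over a prime field *)

Section AffineSpace.
Import GRing.Theory.
Local Open Scope group_scope.
Local Open Scope ring_scope.
Variables p d : nat.
Local Notation V := 'rV['F_p]_d.

Lemma translationE (b v : V) : translation b v = v + b.
Proof. by rewrite permE. Qed.

Fact translations_group_set : group_set (translations p d).
Proof.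
apply/group_setP; split.
  by apply/imsetP; exists 0 => //; apply/permP=> v; rewrite translationE perm1 addr0.
move=> _ _ /imsetP[b _ ->] /imsetP[c _ ->]; apply/imsetP; exists (b + c) => //.
by apply/permP=> v; rewrite permM !translationE addrA.
Qed.
Canonical translations_group := Group translations_group_set.

Lemma mem_translation (b : V) : translation b \in translations p d.
Proof. exact: imset_f. Qed.

Lemma linear_permsP (g : {perm V}) : g \in linear_perms p d ->
  exists2 A : 'M['F_p]_d, A \in unitmx & forall v, g v = v *m A.
Proof.
rewrite inE => /existsP[A /andP[uA /forallP gA]].
by exists A => // v; apply/eqP.
Qed.

Lemma linear_perms0 g : g \in linear_perms p d -> g 0 = 0.
Proof. by case/linear_permsP=> A _ ->; rewrite mul0mx. Qed.

Lemma linear_permsD g (u v : V) :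
  g \in linear_perms p d -> g (u + v) = g u + g v.
Proof. by case/linear_permsP=> A _ gA; rewrite !gA mulmxDl. Qed.

(** Conjugation by a linear [g] turns the translation by [b] into the translation by [g b]. *)
Lemma linear_norm_translations (G0 : {group {perm V}}) :
  G0 \subset linear_perms p d -> (G0 \subset 'N(translations p d))%g.
Proof.
move=> /subsetP linG; apply/subsetP=> g /linG ling.
rewrite inE; apply/subsetP=> _ /imsetP[_ /imsetP[b _ ->] ->].
apply/imsetP; exists (g b) => //; apply/permP=> v.
rewrite -(permKV g v) permJ !translationE permKV.
by rewrite linear_permsD // permKV.
Qed.

(** Translations make [Ghat] transitive, and the orbits of the stabiliser of [x] are the translates
    by [x] of the [G0]-orbits, so counting the latter suffices. *)
Lemma affine_rank (Ghat G0 : {group {perm V}}) n :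
    G0 \subset linear_perms p d ->
    Ghat = (translations p d * G0)%g :> {set {perm V}} ->
    #|orbit 'P G0 @: [set: V]| = n ->
  has_rank Ghat n.
Proof.
move=> /subsetP linG defG rkG; split.
  apply/imsetP; exists 0 => //; apply/esym/setP=> v; rewrite inE.
  apply/orbitP; exists (translation v); last by rewrite /= apermE translationE add0r.
  by rewrite defG -[translation v]mulg1 mem_mulg ?mem_translation.
move=> x; have sTG b : translation b \in Ghat.
  by rewrite defG -[translation b]mulg1 mem_mulg ?mem_translation.
have sG0G : {subset G0 <= Ghat}.
  move=> g Gg; rewrite defG -[g]mul1g mem_mulg ?group1 //.
have orbx v : orbit 'P 'C_Ghat[x | 'P]%g v = translation x @: orbit 'P G0 (v - x).
  apply/setP=> w; apply/orbitP/imsetP.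
    case=> g /setIP[]; rewrite defG => /mulsgP[_ g0 /imsetP[b _ ->] G0g0 ->].
    move/astab1P; rewrite /= !apermE !permM !translationE => gx <-.
    exists (g0 (v - x)); first by apply/orbitP; exists g0.
    rewrite translationE -[X in _ = _ + X]gx -linear_permsD ?linG //.
    by rewrite addrA subrK.
  case=> _ /orbitP[g0 G0g0 <-] ->.
  (* Products of permutations act from left to right: [x] is moved to [0], which [g0] fixes, and
     then back. *)
  exists (translation (- x) * g0 * translation x)%g.
    apply/setIP; split; first by do 2?apply: groupM; rewrite ?sTG ?sG0G.
    apply/astab1P.
    by rewrite /= !apermE !permM !translationE subrr linear_perms0 ?linG ?add0r.
  by rewrite /= !apermE !permM !translationE.
rewrite -rkG -[RHS](card_imset _ (imset_inj (@perm_inj _ (translation x)))).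
congr #|pred_of_set _|; apply/setP=> S; apply/imsetP/imsetP.
  case=> v _ ->; exists (orbit 'P G0 (v - x)) => //; exact: imset_f.
case=> _ /imsetP[v _ ->] ->; exists (v + x) => //.
by rewrite orbx addrK.
Qed.

(** Every scalar of ['F_p] is the image of a natural number, so scaling is repeated addition. *)
Lemma add_closed_subspace (M : {set V}) :
  0 \in M -> {in M &, forall u v, u + v \in M} -> is_subspace M.
Proof.
move=> M0 MD; have MZ (a : 'F_p) v : v \in M -> a *: v \in M.
  move=> Mv; rewrite -[a]natr_Zp scaler_nat.
  by elim: (a : nat) => [|n IHn]; rewrite ?mulr0n // mulrS MD.
exists <<enum M>>%VS; apply/setP=> v; rewrite inE; apply/idP/idP=> [Mv|].
  by rewrite memv_span ?mem_enum.
rewrite -[enum M]/(val (in_tuple (enum M))) => /coord_span->.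
apply: (big_ind (fun u => u \in M)) => // i _; apply: MZ.
by rewrite -mem_enum mem_nth.
Qed.

End AffineSpace.

(** * From a subgroup family in an elementary abelian group to the vector space conditions *)

Section FamilyToVectorSpace.
Import GRing.Theory.
Local Open Scope group_scope.
Variables (gT : finGroupType) (N H : {group gT}) (Ms : {set {group gT}}).
Variable p : nat.
Hypothesis fam : subgroup_family N H Ms.
Hypothesis abelN : p.-abelem N.
Hypothesis ntN : N :!=: 1.

Local Notation V := 'rV['F_p]_('dim N).
Local Notation toN := (rVabelem abelN ntN).
Local Notation toV := (abelem_rV abelN ntN).
Local Notation rH := (abelem_repr abelN ntN (sf_norm fam)).

(** Taking arbitrary sets rather than groups lets the same transport serve for cosets. *)
Definition vec_set (A : {set gT}) : {set V} := [set v | toN v \in A].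
Definition vec_family : {set {set V}} := [set vec_set (M : {group gT}) | M in Ms].
(** This is conjugation by [H] on [N], written in coordinates; passing to the image in [{perm V}]
    avoids assuming that [H] acts faithfully. *)
Definition vec_action : {group {perm V}} := (actperm ('MR rH) @* H)%G.

(** The inclusions matter because [vec_set A] only depends on the part of [A] inside [N]. *)
Lemma vec_set_inj (A B : {set gT}) :
  A \subset N -> B \subset N -> vec_set A = vec_set B -> A = B.
Proof.
move=> sAN sBN /setP eqAB; apply/setP=> x.
have [Nx|nNx] := boolP (x \in N).
  by have := eqAB (toV x); rewrite !inE abelem_rV_K.
by rewrite (contraNF (subsetP sAN x)) ?(contraNF (subsetP sBN x)).
Qed.

Lemma vec_actionP (g : {perm V}) : reflect
  (exists2 h, h \in H & forall v, g v = (v *m rH h)%R) (g \in vec_action).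
Proof.
apply: (iffP morphimP) => [[h _ Hh ->]|[h Hh gE]].
  by exists h => // v; rewrite actpermE /= mx_repr_actE.
exists h => //; apply/permP=> v.
by rewrite gE actpermE /= mx_repr_actE.
Qed.

Lemma vec_action_ex h : h \in H ->
  exists2 g : {perm V}, g \in vec_action & forall v, g v = (v *m rH h)%R.
Proof.
move=> Hh; exists (actperm ('MR rH) h); first exact: mem_morphim.
by move=> v; rewrite actpermE /= mx_repr_actE.
Qed.

Lemma vec_action_linear : vec_action \subset linear_perms p ('dim N).
Proof.
apply/subsetP=> g /vec_actionP[h Hh gE]; rewrite inE; apply/existsP.
by exists (rH h); rewrite (repr_mx_unit rH Hh) andTb; apply/forallP=> v; apply/eqP; exact: gE.
Qed.

Lemma vec_orbitP (v w : V) : reflect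
  (exists2 h, h \in H & toN w = toN v ^ h) (w \in orbit 'P vec_action v).
Proof.
apply: (iffP orbitP) => [[g /vec_actionP[h Hh gE] <-]|[h Hh wE]].
  by exists h => //; rewrite /= apermE gE rVabelemJ.
have [g G0g gE] := vec_action_ex Hh; exists g => //.
by apply: (@rVabelem_inj _ _ _ abelN ntN); rewrite /= apermE gE rVabelemJ.
Qed.

Lemma vec_setJ (A : {set gT}) h (g : {perm V}) : h \in H ->
  (forall v, g v = (v *m rH h)%R) -> setact 'P (vec_set A) g = vec_set (A :^ h).
Proof.
move=> Hh gE; apply/setP=> v; apply/imsetP/idP=> [[u uA ->]|].
  by move: uA; rewrite !inE /= apermE gE rVabelemJ // memJ_conjg.
rewrite inE => /imsetP[x Ax vE]; exists ((g^-1)%g v); last by rewrite /= apermE permKV.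
have := congr1 toN (permKV g v); rewrite gE rVabelemJ // vE => /conjg_inj E.
by rewrite inE E.
Qed.

(** The orbits are the zero vector, the nonzero vectors of the union of the family by [sf_union],
    and the complement [W] of that union by [sf_compl]. The number is 2 or 3 according to whether
    [W] is empty. *)
Lemma vec_orbits : #|orbit 'P vec_action @: [set: V]| = 2 \/
  #|orbit 'P vec_action @: [set: V]| = 3.
Proof.
have /card_gt0P[M MMs] : 0 < #|Ms| by rewrite ltnW ?(sf_card fam).
have [x Mx ntx] := trivgPn _ (sf_nontrivial fam MMs).
have Nx := subsetP (sf_sub fam MMs) x Mx.
pose U := \bigcup_(M in Ms) (M : {set gT})^#.
have Ux : x \in U by apply/bigcupP; exists M; rewrite // !inE ntx.
have orb0 : orbit 'P vec_action 0%R = [set 0%R].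
  apply/setP=> v; rewrite inE; apply/vec_orbitP/eqP=> [[h _]|->].
    by rewrite rVabelem0 conj1g => v1; apply: (@rVabelem_inj _ _ _ abelN ntN); rewrite rVabelem0.
  by exists 1; rewrite ?group1 // conjg1.
have orbU v : toN v \in U -> orbit 'P vec_action v = orbit 'P vec_action (toV x).
  move=> Uv; apply/orbit_eqP/vec_orbitP; rewrite abelem_rV_K //.
  exact: (sf_union fam Ux Uv).
have ne0x : orbit 'P vec_action 0%R != orbit 'P vec_action (toV x).
  rewrite orb0; apply: contraNneq ntx => E.
  have : toV x \in [set 0%R] by rewrite E orbit_refl.
  by rewrite inE => /eqP/(congr1 toN); rewrite abelem_rV_K // rVabelem0 => ->.
pose W := N :\: \bigcup_(M in Ms) (M : {set gT}).
have inU y : y \in N -> y \notin W -> y != 1 -> y \in U.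
  move=> Ny; rewrite inE Ny andbT negbK => /bigcupP[L LMs Ly] nty.
  by apply/bigcupP; exists L; rewrite // !inE nty.
have orbs v : toN v \notin W ->
    orbit 'P vec_action v \in [set orbit 'P vec_action 0%R; orbit 'P vec_action (toV x)].
  move=> nWv; rewrite !inE; have [v1|ntv] := eqVneq (toN v) 1.
    suff -> : v = 0%R by rewrite eqxx.
    by apply: (@rVabelem_inj _ _ _ abelN ntN); rewrite rVabelem0.
  by rewrite (orbU v) ?eqxx ?orbT // inU // mem_rVabelem.
have [W0|/set0Pn[y Wy]] := eqVneq W set0; [left | right].
  transitivity #|[set orbit 'P vec_action 0%R; orbit 'P vec_action (toV x)]|.
    congr #|pred_of_set _|; apply/setP=> S; apply/imsetP/idP=> [[v _ ->]|].
      by apply: orbs; rewrite W0 inE.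
    by rewrite !inE => /orP[]/eqP->; [exists 0%R | exists (toV x)].
  by rewrite cards2 ne0x.
have /setDP[Ny nUy] := Wy.
(* [W] is stable under [H], since [H] permutes the members of the family; hence no orbit meets both
   [W] and its complement. *)
have neW v : toN v \notin W ->
    orbit 'P vec_action (toV y) != orbit 'P vec_action v.
  apply: contraNneq => E.
  have /vec_orbitP[h Hh ->] : v \in orbit 'P vec_action (toV y) by rewrite E orbit_refl.
  rewrite abelem_rV_K // inE (memJ_norm _ (subsetP (sf_norm fam) h Hh)) Ny andbT.
  apply: contra nUy => /bigcupP[L LMs Lyh].
  apply/bigcupP; exists (L :^ h^-1)%G; first by rewrite (sf_stable fam) ?groupV.
  by rewrite /= mem_conjg invgK.
have nW1 : 1 \notin W.
  by rewrite inE group1 andbT negbK; apply/bigcupP; exists M.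
have nWx : x \notin W.
  by rewrite inE Nx andbT negbK; apply/bigcupP; exists M.
transitivity #|orbit 'P vec_action (toV y) |:
    [set orbit 'P vec_action 0%R; orbit 'P vec_action (toV x)]|.
  congr #|pred_of_set _|; apply/setP=> S; apply/imsetP/idP=> [[v _ ->]|].
    have [Wv|nWv] := boolP (toN v \in W); last by rewrite inE orbs ?orbT.
    suff -> : orbit 'P vec_action v = orbit 'P vec_action (toV y) by rewrite setU11.
    apply/orbit_eqP/vec_orbitP; rewrite abelem_rV_K //.
    exact: (sf_compl fam Wy Wv).
  rewrite !inE => /or3P[]/eqP->.
  - by exists (toV y).
  - by exists 0%R.
  by exists (toV x).
by rewrite cardsU1 cards2 ne0x !inE negb_or !neW // ?rVabelem0 ?abelem_rV_K.
Qed.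
Lemma vec_coset (A : {set gT}) v :
  coset_by (vec_set A) v = vec_set (toN v *: A).
Proof.
apply/setP=> w; apply/imsetP/idP=> [[u + ->]|].
  by rewrite !inE rVabelemD mem_lcoset mulKg.
rewrite inE mem_lcoset => Aw; exists (w - v)%R; last by rewrite addrC subrK.
by rewrite inE addrC rVabelemD rVabelemN.
Qed.

Lemma vec_set_group_inj : {in Ms &, injective (fun M : {group gT} => vec_set M)}.
Proof.
move=> M L MMs LMs /vec_set_inj eqML; apply/group_inj.
exact: eqML (sf_sub fam MMs) (sf_sub fam LMs).
Qed.

Lemma mem_vec_family (M : {group gT}) : M \in Ms -> vec_set M \in vec_family.
Proof. exact: imset_f. Qed.

Lemma vec_familyJ S g :
  S \in vec_family -> g \in vec_action -> setact 'P S g \in vec_family.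
Proof.
case/imsetP=> M MMs -> /vec_actionP[h Hh gE].
by rewrite (vec_setJ _ Hh gE) (mem_vec_family (sf_stable fam MMs Hh)).
Qed.

Lemma vec_family_2trans : [transitive^2 vec_action, on vec_family | 'P^*].
Proof.
have /card_gt0P[M MMs] : 0 < #|Ms| by rewrite ltnW ?(sf_card fam).
have [L LMs neML] := sf_other fam MMs.
have t0P : [tuple vec_set M; vec_set L] \in 2.-dtuple(vec_family).
  rewrite inE /= inE andbT (inj_in_eq vec_set_group_inj) // neML /=.
  by apply/subsetP=> S; rewrite !inE => /orP[]/eqP->; apply: mem_vec_family.
apply/imsetP; exists [tuple vec_set M; vec_set L] => //.
apply/setP=> t; apply/idP/orbitP=> [|[g G0g <-]]; last first.
  apply: n_act_dtuple t0P; apply/astabsP=> S.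
  apply/idP/idP=> [gS|]; last by move/vec_familyJ; apply.
  by rewrite -(actK 'P^* g S) /= vec_familyJ ?groupV.
case/tupleP: t => S t; case/tupleP: t => T t; rewrite [t]tuple0.
rewrite inE /= inE andbT => /andP[neST /subsetP sST].
have /imsetP[M' M'Ms defS] : S \in vec_family by rewrite sST // !inE eqxx.
have /imsetP[L' L'Ms defT] : T \in vec_family by rewrite sST // !inE eqxx orbT.
have neML' : M' != L'.
  by apply: contraNneq neST => eqML; rewrite defS defT eqML.
have [h [Hh MhM' LhL']] := sf_2trans fam MMs LMs M'Ms L'Ms neML neML'.
have [g G0g gE] := vec_action_ex Hh; exists g => //; apply/val_inj=> /=.
by rewrite !(vec_setJ _ Hh gE) defS defT -MhM' -LhL'.
Qed.

(** [Ghat] is generated by the translations and [vec_action]; it is their product because linear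
    permutations normalise the translations. The remaining conditions are those of the family,
    transported to [V]. *)
Lemma vec_conditions (M1 M2 : {group gT}) : prime p -> 2 < #|Ms| ->
    M1 \in Ms -> M2 \in Ms -> M1 != M2 ->
  exists Ghat : {group {perm V}},
    vs_conditions #|Ms| Ghat vec_action vec_family (vec_set M1) (vec_set M2).
Proof.
move=> p_pr cardMs M1Ms M2Ms neM12.
have cNN : abelian N := abelem_abelian abelN.
have linG := vec_action_linear.
pose Ghat := (translations_group p ('dim N) <*> vec_action)%G.
have defG : Ghat = translations p ('dim N) * vec_action :> {set {perm V}}.
  exact/norm_joinEr/linear_norm_translations.
exists Ghat; split=> //.
- by have [rk|rk] := vec_orbits; [left | right]; apply: affine_rank rk.
- move=> _ /imsetP[M MMs ->]; apply: add_closed_subspace.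
    by rewrite inE rVabelem0.
  by move=> u v; rewrite !inE rVabelemD; apply: groupM.
- by split; rewrite // card_in_imset //; apply: vec_set_group_inj.
- exact: mem_vec_family.
- exact: mem_vec_family.
- by rewrite (inj_in_eq vec_set_group_inj).
- apply/setP=> S; apply/idP/orbitP=> [/imsetP[M MMs ->]|[g G0g <-]]; last first.
    by apply: vec_familyJ; rewrite ?mem_vec_family.
  have [L LMs neML] := sf_other fam MMs.
  have [h [Hh <- _]] := sf_2trans fam M1Ms M2Ms MMs LMs neM12 neML.
  have [g G0g gE] := vec_action_ex Hh.
  by exists g; rewrite //= (vec_setJ _ Hh gE).
- exact: vec_family_2trans.
- apply/setP=> w; rewrite inE.
  have: toN w \in M1 * M2 by rewrite (sf_mul fam M1Ms M2Ms neM12) mem_rVabelem.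
  case/mulsgP=> x y M1x M2y wE.
  have [Nx Ny] := (subsetP (sf_sub fam M1Ms) x M1x, subsetP (sf_sub fam M2Ms) y M2y).
  apply/imset2P; exists (toV x) (toV y); rewrite ?inE ?abelem_rV_K //.
  by rewrite -abelem_rV_M // -wE rVabelemK.
- have [_ [x Nx nM1x]] := properP (sf_proper fam M1Ms).
  have NMx : x \in N :\: M1 by rewrite inE nM1x.
  apply/imsetP; exists (vec_set (x *: M1)).
    by apply/imsetP; exists (toV x); rewrite ?vec_coset ?inE abelem_rV_K.
  apply/setP=> S; apply/imsetP/orbitP=> [[v]|[g /setIP[G0g /astab1P gM] <-]].
    rewrite !inE => nM1v ->; have NMv : toN v \in N :\: M1 by rewrite inE nM1v mem_rVabelem.
    have [h [Hh M1h]] := sf_quot fam M1Ms NMx NMv.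
    case/mulsgP=> m1 w Mm1 /lcosetP[m2 Mm2 ->] vE.
    have [g G0g gE] := vec_action_ex Hh; exists g.
      rewrite inE G0g; apply/astab1P; rewrite /= (vec_setJ _ Hh gE).
      by rewrite -[M1 :^ h]/(gval (M1 :^ h)%G) M1h.
    rewrite /= (vec_setJ _ Hh gE) vec_coset; congr vec_set.
    rewrite conjsMg conjg_set1 -[M1 :^ h]/(gval (M1 :^ h)%G) M1h.
    (* As [N] is abelian, the double coset supplied by [sf_quot] collapses to the single coset
       [x ^ h *: M1]. *)
    have Nxh : x ^ h \in N by rewrite memJ_norm // (subsetP (sf_norm fam)).
    have Nm1 := subsetP (sf_sub fam M1Ms) m1 Mm1.
    rewrite mulgA (centsP cNN m1 Nm1 _ Nxh) -mulgA in vE.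
    apply/lcoset_eqP; rewrite mem_lcoset vE invMg mulgKV.
    by rewrite groupV groupM.
  have [h Hh gE] := vec_actionP _ G0g.
  move: gM; rewrite /= !(vec_setJ _ Hh gE) conjsMg conjg_set1.
  have Nxh : x ^ h \in N by rewrite memJ_norm // (subsetP (sf_norm fam)).
  have sM1h : M1 :^ h \subset N := sf_sub fam (sf_stable fam M1Ms Hh).
  move/(vec_set_inj sM1h (sf_sub fam M1Ms)) => M1h; rewrite M1h.
  exists (toV (x ^ h)); last by rewrite vec_coset abelem_rV_K.
  rewrite !inE abelem_rV_K //.
  by rewrite -M1h memJ_conjg nM1x.
have [x M1x ntx] := trivgPn _ (sf_nontrivial fam M1Ms).
have Nx := subsetP (sf_sub fam M1Ms) x M1x.
have memU v : (v \in \bigcup_(S in vec_family) (S :\ 0%R)) =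
    (toN v \in \bigcup_(M in Ms) M^#).
  apply/bigcupP/bigcupP=> [[_ /imsetP[M MMs ->]]|[M MMs]]; rewrite !inE.
    case/andP=> ntv Mv; exists M; rewrite // !inE Mv andbT.
    by apply: contra_neq ntv => v1; apply: (@rVabelem_inj _ _ _ abelN ntN); rewrite rVabelem0.
  case/andP=> ntv Mv; exists (vec_set M); rewrite ?mem_vec_family // !inE Mv andbT.
  by apply: contra_neq ntv => ->; rewrite rVabelem0.
exists (toV x); apply/setP=> v; rewrite memU.
have Ux : x \in \bigcup_(M in Ms) M^# by apply/bigcupP; exists M1; rewrite // !inE ntx.
apply/idP/vec_orbitP=> [Uv|[h Hh]]; rewrite abelem_rV_K //.
  exact: (sf_union fam Ux Uv).
move=> ->; apply/bigcupP; exists (M1 :^ h)%G; first exact: (sf_stable fam M1Ms Hh).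
by rewrite !inE memJ_conjg M1x -(conj1g h) (inj_eq (@conjg_inj _ h)) ntx.
Qed.

End FamilyToVectorSpace.

(** * The block stabilisers of a nicely affine design with regular [N] form a subgroup family *)

Section NicelyAffine.
Local Open Scope group_scope.
Variables (D : design) (G N : {group {perm elem D}}) (x0 : elem D).
Hypothesis nsNG : N <| G.
Hypothesis Gpair : pairwise_transitive G.
Hypothesis Naff : nicely_affine N.
Hypothesis Nreg : regular_on N (points D).
Hypothesis classes_gt2 : 2 < #|parallel_classes N|.
Hypothesis nonempty_blocks : {in blocks D, forall b, exists x, incident x b}.
Hypothesis not_complete : exists x b : elem D, non_incident x b.
Hypothesis x0P : x0 \in points D.

Implicit Types (x y b c : elem D) (g h n : {perm elem D}).

Definition base_blocks : {set elem D} := [set b | incident x0 b].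
Definition block_stab b : {group {perm elem D}} := ('C_N[b | 'P])%G.
Definition base_stabs : {set {group {perm elem D}}} := block_stab @: base_blocks.
Local Notation H := ('C_G[x0 | 'P])%G.

Lemma autG g : g \in G -> [/\ forall x, (g x \in points D) = (x \in points D),
  forall x, (g x \in blocks D) = (x \in blocks D) &
  forall x b, incident (g x) (g b) = incident x b].
Proof.
have [/subsetP sGA _ _ _] := Gpair.
move=> /sGA; rewrite inE => /and3P[/forallP gP /forallP gB /forallP gI].
split=> [x|x|x b]; first exact/eqP; first exact/eqP.
by have /forallP/(_ b)/eqP := gI x.
Qed.

Lemma sNG : N \subset G. Proof. exact: normal_sub nsNG. Qed.
Let GN n (Nn : n \in N) : n \in G := subsetP sNG n Nn.

Lemma incG g x b : g \in G -> incident (g x) (g b) = incident x b.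
Proof. by case/autG. Qed.

Lemma inc_block x b : incident x b -> b \in blocks D.
Proof. by case/incident_pb/andP. Qed.

Lemma inc_point x b : incident x b -> x \in points D.
Proof. by case/incident_pb/andP. Qed.

Lemma moveN x y : x \in points D -> y \in points D ->
  exists2 n, n \in N & n x = y.
Proof.
move=> Px Py; have [tr _] := Nreg.
by have [n Nn ->] := atransP2 tr Px Py; exists n.
Qed.

Lemma moveN0 x : x \in points D -> exists2 n, n \in N & n x0 = x.
Proof. exact: moveN. Qed.

Lemma regN n m : n \in N -> m \in N -> n x0 = m x0 -> n = m.
Proof.
move=> Nn Nm eqnm; have [_ /(_ x0 x0P) fix1] := Nreg.
apply/eqP; rewrite eq_mulgV1 -in_set1 -[[set _]]/(1 : {set _}) -fix1.
rewrite inE groupM ?groupV //=; apply/astab1P.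
by rewrite /= apermE permM eqnm permK.
Qed.

(** Distinct blocks of one parallel class are disjoint, so a point determines the block of a given
    class through it. *)
Lemma same_class_eq b c x n : n \in N -> n b = c ->
  incident x b -> incident x c -> b = c.
Proof.
move=> Nn nb xb xc; have [_ _ [mu muE]] := Naff.
apply/eqP; apply/negPn/negP => nebc.
have := muE b c (inc_block xb) (inc_block xc) nebc.
have -> : c \in orbit 'P N b by apply/orbitP; exists n.
by move/eqP; rewrite cards_eq0 => /eqP/setP/(_ x); rewrite !inE xb xc.
Qed.

Lemma class_through x b : x \in points D -> b \in blocks D ->
  exists2 n, n \in N & incident x (n b).
Proof.
move=> Px /nonempty_blocks[y yb].
have [n Nn <-] := moveN (inc_point yb) Px.
by exists n; rewrite // incG // GN.
Qed.

(** The point is that [mu] is not zero: moving [b] and [c] within their classes gives two blocks of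
    different classes that share [x0]. *)
Lemma diff_class_meet b c : b \in blocks D -> c \in blocks D ->
  c \notin orbit 'P N b -> exists x, incident x b && incident x c.
Proof.
move=> Bb Bc ncb; have [_ _ [mu muE]] := Naff.
have nebc : b != c by apply: contraNneq ncb => ->; rewrite orbit_refl.
have [n Nn x0b] := class_through x0P Bb.
have [m Nm x0c] := class_through x0P Bc.
have ncb' : m c \notin orbit 'P N (n b).
  apply: contra ncb => /orbitP[k Nk]; rewrite /= apermE => E; apply/orbitP.
  exists (n * k * m^-1); first by rewrite !groupM ?groupV.
  by rewrite /= apermE !permM E permK.
have /card_gt0P[x] : 0 < #|common_points b c|; last by rewrite inE; exists x.
rewrite muE // (negPf ncb) lt0n; apply/eqP=> mu0.
have := muE _ _ (inc_block x0b) (inc_block x0c).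
rewrite (negPf ncb') mu0 => /(_ _)/eqP; rewrite cards_eq0.
have -> : n b != m c by apply: contraNneq ncb' => ->; rewrite orbit_refl.
by move=> /(_ isT)/eqP/setP/(_ x0); rewrite !inE x0b x0c.
Qed.

Lemma mem_block_stab b n : (n \in block_stab b) = (n \in N) && (n b == b).
Proof.
apply/setIP/andP=> -[Nn]; [move/astab1P | move/eqP] => nb; split=> //.
  by apply/eqP; rewrite -apermE.
by apply/astab1P; rewrite /= apermE.
Qed.

(** If [n x0] lies on [b], then [b] and [n b] are blocks of one class sharing this point, hence
    equal. Thus the stabiliser of [b] is the point set of [b] under the identification of points
    with [N]. *)
Lemma block_stabP b n : b \in base_blocks -> n \in N ->
  (n \in block_stab b) = incident (n x0) b.
Proof.
rewrite inE => x0b Nn; apply/idP/idP=> [/setIP[_ /astab1P /= nb]|nx0b].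
  by rewrite -[X in incident _ X]nb apermE incG ?GN.
rewrite inE Nn; apply/astab1P; rewrite /= apermE.
apply/esym/(same_class_eq Nn erefl nx0b).
by rewrite incG ?GN.
Qed.

Lemma base_blocks_class b c : b \in base_blocks -> c \in base_blocks -> b != c ->
  c \notin orbit 'P N b.
Proof.
rewrite !inE => x0b x0c; apply: contra => /orbitP[n Nn nb].
by rewrite (same_class_eq Nn nb x0b x0c).
Qed.

(** For [n] in [N] the blocks [n b] and [c] are in different classes and so meet, say in [m x0].
    Then [m] stabilises [c] and [n * m^-1] stabilises [b]. *)
Lemma block_stab_mul b c : b \in base_blocks -> c \in base_blocks -> b != c ->
  block_stab b * block_stab c = N.
Proof.
move=> x0b x0c nebc; apply/eqP; rewrite eqEsubset mul_subG ?subsetIl //=.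
apply/subsetP=> n Nn; have nc := base_blocks_class x0b x0c nebc.
have [||| y /andP[yb yc]] := @diff_class_meet (n b) c.
- by have [_ -> _] := autG (GN Nn); move: x0b; rewrite inE => /inc_block.
- by move: x0c; rewrite inE => /inc_block.
- apply: contra nc => /orbitP[k Nk]; rewrite /= apermE => E; apply/orbitP.
  by exists (n * k); rewrite ?groupM //= apermE permM.
have [m Nm my] := moveN0 (inc_point yc).
have Nmn : m * n^-1 \in N by rewrite groupM ?groupV.
apply/mulsgP; exists (n * m^-1) m.
- rewrite -groupV invMg invgK block_stabP // permM my.
  by rewrite -(incG _ _ (GN Nn)) permKV.
- by rewrite block_stabP // my.
by rewrite mulgKV.
Qed.

(** Each parallel class has exactly one block through [x0]. *)
Lemma card_base_blocks : #|base_blocks| = #|parallel_classes N|.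
Proof.
rewrite -(card_in_imset (f := orbit 'P N) (D := mem base_blocks)); last first.
  move=> b c x0b x0c E; apply/eqP; apply/negPn/negP => nebc.
  by have /negP[] := base_blocks_class x0b x0c nebc; rewrite E orbit_refl.
congr #|pred_of_set _|; apply/setP=> S; apply/imsetP/imsetP=> -[b].
  by rewrite inE => /inc_block Bb ->; exists b.
move=> Bb ->; have [n Nn x0nb] := class_through x0P Bb.
exists (n b); first by rewrite inE.
by apply/esym/orbit_eqP; apply/orbitP; exists n.
Qed.

Lemma trans_blocks b c : b \in blocks D -> c \in blocks D ->
  exists2 g, g \in G & g b = c.
Proof.
move=> /nonempty_blocks[x xb] /nonempty_blocks[y yc].
have [_ [tr _] _ _] := Gpair.
by have [g [Gg _ gb]] := tr _ _ _ _ xb yc; exists g.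
Qed.

(** A block stabilised by all of [N] would contain every point; as [G] is transitive on blocks, so
    would every block, against [not_complete]. *)
Lemma block_stab_proper b : b \in base_blocks -> block_stab b \proper N.
Proof.
move=> x0b; rewrite properEneq subsetIl andbT; apply/eqP=> stabN.
have [y [c /and3P[Py Bc /negP[]]]] := not_complete.
have Bb : b \in blocks D by move: x0b; rewrite inE => /inc_block.
have [g Gg gb] := trans_blocks Bb Bc.
have [gP _ gI] := autG Gg.
have [n Nn ny] : exists2 n, n \in N & n x0 = g^-1 y.
  by apply: moveN0; rewrite -gP permKV.
rewrite -gb -[y](permKV g) gI -ny -block_stabP //.
by rewrite stabN.
Qed.

Lemma block_stab_inj : {in base_blocks &, injective block_stab}.
Proof.
move=> b c x0b x0c E; apply/eqP; apply/negPn/negP => nebc.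
have := block_stab_proper x0b.
by rewrite -(block_stab_mul x0b x0c nebc) E mulGid properxx.
Qed.

Lemma card_base_stabs : #|base_stabs| = #|parallel_classes N|.
Proof. by rewrite card_in_imset ?card_base_blocks //; apply: block_stab_inj. Qed.

Lemma stabHP g : reflect (g \in G /\ g x0 = x0) (g \in H).
Proof. by apply: (iffP setIP) => -[Gg]; [move/astab1P|move=> ?; split=> //; apply/astab1P]. Qed.

Lemma normN g n : g \in G -> n \in N -> n ^ g \in N.
Proof. by move=> Gg Nn; rewrite memJ_norm // (subsetP (normal_norm nsNG)). Qed.

Lemma base_blocksJ b h : b \in base_blocks -> h \in H -> h b \in base_blocks.
Proof.
by move=> + /stabHP[Gh hx0]; rewrite !inE => x0b; rewrite -{1}hx0 incG.
Qed.

Lemma block_stabJ b h : h \in G -> (block_stab b :^ h)%G = block_stab (h b).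
Proof.
move=> Gh; apply/group_inj/setP=> n /=.
rewrite mem_conjg !mem_block_stab.
have -> : (n ^ h^-1 \in N) = (n \in N).
  by rewrite memJ_norm // groupV (subsetP (normal_norm nsNG)).
rewrite conjgE invgK !permM; congr (_ && _); apply/eqP/eqP=> [E|->].
  by rewrite -[in RHS]E permKV.
by rewrite permK.
Qed.

Lemma base_stab_2trans b c b' c' : b \in base_blocks -> c \in base_blocks ->
    b' \in base_blocks -> c' \in base_blocks -> b != c -> b' != c' ->
  exists h, [/\ h \in H, h b = b' & h c = c'].
Proof.
move=> x0b x0c x0b' x0c' nebc nebc'; have [_ _ _ [tr _]] := Gpair.
have int d e : d \in base_blocks -> e \in base_blocks -> d != e -> intersecting d e.
  rewrite !inE => x0d x0e nede; rewrite /intersecting nede (inc_block x0d) (inc_block x0e).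
  by apply/set0Pn; exists x0; rewrite inE x0d x0e.
have [g [Gg gb gc]] := tr _ _ _ _ (int _ _ x0b x0c nebc) (int _ _ x0b' x0c' nebc').
have [gP _ _] := autG Gg.
have [n Nn nx0] : exists2 n, n \in N & n x0 = g x0 by apply: moveN0; rewrite gP.
have Hh : g * n^-1 \in H.
  by apply/stabHP; split; [rewrite groupM ?groupV // GN | rewrite permM -nx0 permK].
exists (g * n^-1).
(* Correcting [g] by [n^-1] makes it fix [x0] and keeps the image of [d] in the class of [e]; only
   one block of that class passes through [x0]. *)
have mv d e : d \in base_blocks -> e \in base_blocks -> g d = e -> (g * n^-1)%g d = e.
  move=> x0d x0e gd; apply: (@same_class_eq _ _ x0 n Nn).
  - by rewrite permM gd permKV.
  - by have := base_blocksJ x0d Hh; rewrite inE.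
  - by rewrite inE in x0e.
by split=> //; apply: mv.
Qed.

(** Since [g] fixes [x0], its action on the points [n x0] is conjugation on [N], by regularity. *)
Lemma stabH_conj g n m : g \in H -> n \in N -> m \in N ->
  g (n x0) = m x0 -> m = n ^ g.
Proof.
move=> /stabHP[Gg gx0] Nn Nm E; apply: regN; rewrite ?normN //.
have gVx0 : g^-1 x0 = x0 by rewrite -{1}gx0 permK.
by rewrite conjgE !permM gVx0 E.
Qed.

Lemma base_stabs_unionP n : n \in N ->
  (n \in \bigcup_(M in base_stabs) M) = [exists b, incident x0 b && incident (n x0) b].
Proof.
move=> Nn; apply/bigcupP/existsP=> [[_ /imsetP[b x0b ->]]|[b /andP[x0b nx0b]]].
  by rewrite block_stabP // => nx0b; exists b; rewrite inE in x0b; rewrite x0b.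
have Bb : b \in base_blocks by rewrite inE.
by exists (block_stab b); rewrite ?imset_f ?block_stabP.
Qed.

(** The transitivity fields are pairwise transitivity read at [x0]: intersecting blocks give
    [sf_2trans], collinear and non-collinear points [x0], [n x0] give [sf_union] and [sf_compl], and
    non-intersecting blocks [b], [n b] give [sf_quot]. *)
Lemma base_stabs_family : subgroup_family N H base_stabs.
Proof.
have [_ _ [trC trNC] [_ trNI]] := Gpair.
have nP n : n \in N -> n x0 \in points D.
  by move=> Nn; have [-> _ _] := autG (GN Nn).
have ne1 n : n \in N -> n != 1 -> x0 != n x0.
  move=> Nn; apply: contraNneq => nx0; apply/eqP/regN; rewrite ?group1 // perm1.
  by rewrite -nx0.
split.
- exact: subset_trans (subsetIl _ _) (normal_norm nsNG).
- by rewrite card_base_stabs ltnW.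
- by move=> _ /imsetP[b x0b ->]; apply: block_stab_proper.
- move=> _ _ /imsetP[b x0b ->] /imsetP[c x0c ->] ne; apply: block_stab_mul => //.
  by apply: contraNneq ne => ->.
- move=> _ h /imsetP[b x0b ->] Hh; have [Gh _] := stabHP _ Hh.
  by rewrite block_stabJ ?imset_f ?base_blocksJ.
- move=> _ _ _ _ /imsetP[b x0b ->] /imsetP[c x0c ->] /imsetP[b' x0b' ->] /imsetP[c' x0c' ->].
  move=> nebc nebc'; have [||h [Hh <- <-]] := base_stab_2trans x0b x0c x0b' x0c'.
  + by apply: contraNneq nebc => ->.
  + by apply: contraNneq nebc' => ->.
  by have [Gh _] := stabHP _ Hh; exists h; rewrite !block_stabJ.
- have col n : n \in \bigcup_(M in base_stabs) M^# -> n \in N /\ collinear x0 (n x0).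
    case/bigcupP=> M; case/imsetP=> b x0b ->; rewrite 2!inE => /andP[ntn Mn].
    have Nn : n \in N by case/setIP: Mn.
    rewrite block_stabP // in Mn; rewrite inE in x0b.
    split=> //; rewrite /collinear x0P nP // ne1 //=.
    by apply/existsP; exists b; rewrite x0b.
  move=> n m /col[Nn cn] /col[Nm cm].
  have [g [Gg gx0 gn]] := trC _ _ _ _ cn cm.
  have Hg : g \in H by apply/stabHP.
  by exists g => //; apply: stabH_conj.
- have ncol n : n \in N :\: \bigcup_(M in base_stabs) M -> n \in N /\ non_collinear x0 (n x0).
    case/setDP=> Nn; rewrite base_stabs_unionP // => nn; split=> //.
    rewrite /non_collinear x0P nP // nn andbT ne1 //.
    apply: contraNneq nn => ->.
    have /card_gt0P[b x0b] : 0 < #|base_blocks| by rewrite card_base_blocks ltnW // ltnW.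
    by apply/existsP; exists b; rewrite perm1 andbb; rewrite inE in x0b.
  move=> n m /ncol[Nn cn] /ncol[Nm cm].
  have [g [Gg gx0 gn]] := trNC _ _ _ _ cn cm.
  have Hg : g \in H by apply/stabHP.
  by exists g => //; apply: stabH_conj.
move=> _ /imsetP[b x0b ->].
have nint n : n \in N :\: block_stab b -> n \in N /\ non_intersecting b (n b).
  case/setDP=> Nn Mn; split=> //.
  have Bb : b \in blocks D by move: x0b; rewrite inE => /inc_block.
  have [_ nB _] := autG (GN Nn).
  rewrite /non_intersecting Bb nB Bb /=; apply/andP; split.
    apply: contraNneq Mn => E; rewrite inE Nn; apply/astab1P.
    by rewrite /= apermE -E.
  apply: contraNT Mn => /set0Pn[y]; rewrite inE => /andP[yb ynb].
  rewrite inE Nn; apply/astab1P; rewrite /= apermE.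
  exact/esym/(same_class_eq Nn erefl yb ynb).
(* The automorphism [g] fixes [b] and sends [n b] to [m b], but may move [x0] along [b]. The element
   [k] undoing this stabilises [b], so [h] fixes both [x0] and [b]; and [n ^ h * k * m^-1] fixes
   [b], which puts [m] in the double coset of [n ^ h]. *)
move=> n m /nint[Nn cn] /nint[Nm cm].
have [g [Gg gb gn]] := trNI _ _ _ _ cn cm.
have [gP _ gI] := autG Gg.
have [k Nk kx0] : exists2 k, k \in N & k x0 = g x0 by apply: moveN0; rewrite gP.
have Mk : k \in block_stab b.
  by rewrite block_stabP // kx0 -[X in incident _ X]gb gI; rewrite inE in x0b.
have kb : k b = b by case/setIP: Mk => _ /astab1P.
pose h := g * k^-1.
have Hh : h \in H.
  by apply/stabHP; split; [rewrite groupM ?groupV // GN | rewrite permM -kx0 permK].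
have [Gh _] := stabHP _ Hh.
have hb : h b = b by rewrite permM gb -{1}kb permK.
exists h; split=> //; first by rewrite block_stabJ // hb.
have Nnh := normN Gh Nn.
have Mz : n ^ h * k * m^-1 \in block_stab b.
  rewrite mem_block_stab (groupM (groupM Nnh Nk)) ?groupV //=; apply/eqP.
  have kh y : k (h y) = g y by rewrite permM permKV.
  have hVb : h^-1 b = b by rewrite -{1}hb permK.
  by rewrite conjgE (permM _ m^-1) (permM _ k) (permM h^-1) hVb (permM n) kh gn permK.
apply/mulsgP; exists (n ^ h * k * m^-1)^-1 (n ^ h * k).
- by rewrite groupV.
- by rewrite mem_lcoset mulKg.
by rewrite invMg invgK mulgKV.
Qed.

End NicelyAffine.

Lemma points_or_blocks (D : design) (x : elem D) :
  (x \in blocks D) = (x \notin points D).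
Proof.
have := in_setT x; rewrite -design_cover inE.
case: (boolP (x \in points D)) => [Px _|_ /= ->] //.
by rewrite (disjointFr (design_disjoint D) Px).
Qed.

(** * Recognising a design of cosets by a bijection between vectors and points *)

Section DesignIso.
Variables (p d : nat) (D : design) (Ms : {set {set 'rV['F_p]_d}}).
Variable psi : 'rV['F_p]_d -> elem D.

Definition point_preimage (b : elem D) : {set 'rV['F_p]_d} :=
  [set v | incident (psi v) b].

Lemma vs_design_iso : injective psi -> psi @: [set: _] = points D ->
    {in blocks D &, injective point_preimage} ->
    point_preimage @: blocks D = vs_blocks Ms ->
  design_iso D (vs_design Ms).
Proof.
move=> psi_inj psi_im pre_inj pre_im.
(* The default values only make [f] total: every point is some [psi v], and [insub] succeeds on
   every block because its preimage lies in [vs_blocks Ms]. *)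
pose f x : vs_elem Ms := if x \in points D then inl (odflt 0%R [pick v | psi v == x])
  else oapp inr (inl 0%R) (insub (point_preimage x)).
have psiP v : psi v \in points D by rewrite -psi_im imset_f ?inE.
have fP v : f (psi v) = inl v.
  rewrite /f psiP; case: pickP => [w /eqP/psi_inj->|/(_ v)] //.
  by rewrite eqxx.
have fB b : b \in blocks D -> exists2 s, f b = inr s & val s = point_preimage b.
  move=> Bb; rewrite /f -(negbK (b \in points D)) -points_or_blocks Bb /=.
  case: insubP => [s _ sE|]; first by exists s.
  by rewrite -pre_im imset_f.
have ptP x : x \in points D -> exists v, x = psi v.
  by rewrite -psi_im => /imsetP[v _ ->]; exists v.
have split_elem x : (exists v, x = psi v) \/ x \in blocks D.
  by rewrite points_or_blocks; case: (boolP (x \in points D)) => [/ptP|]; [left | right].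
have nB v : psi v \in blocks D = false by rewrite points_or_blocks psiP.
have f_inj : injective f.
  move=> x y; have [[v ->]|Bx] := split_elem x; have [[w ->]|By] := split_elem y.
  - by rewrite !fP => -[->].
  - by have [s -> _] := fB _ By; rewrite fP.
  - by have [s -> _] := fB _ Bx; rewrite fP.
  have [s -> sE] := fB _ Bx; have [t -> tE] := fB _ By => -[st].
  by apply: pre_inj; rewrite // -sE -tE st.
exists f; split.
(* Injectivity being known, bijectivity follows by counting once [f] is seen to reach every vector
   and every coset. *)
- apply: inj_card_bij => //; apply: leq_trans (leq_imset_card f (elem D)).
  rewrite -cardsT; apply/subset_leq_card/subsetP=> -[v|s] _.
    by apply/imsetP; exists (psi v); rewrite ?fP.
  have /imsetP[b Bb sE] : val s \in point_preimage @: blocks D.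
    by rewrite pre_im (valP s).
  have [t fb tE] := fB _ Bb; apply/imsetP; exists b => //.
  by rewrite fb; congr inr; apply/val_inj; rewrite tE.
- move=> x; have [[v ->]|Bx] := split_elem x; first by rewrite fP psiP inE.
  have [s -> _] := fB _ Bx; rewrite inE.
  by move: Bx; rewrite points_or_blocks => /negPf.
- move=> x; have [[v ->]|Bx] := split_elem x; first by rewrite fP nB !inE.
  by have [s -> _] := fB _ Bx; rewrite Bx !inE.
move=> x y; have [[v ->]|Bx] := split_elem x; last first.
  have [s -> _] := fB _ Bx; apply/esym/negP => /incident_pb/andP[Px _].
  by rewrite points_or_blocks Px in Bx.
rewrite fP; have [[w ->]|By] := split_elem y.
  by rewrite fP /=; apply/esym/negP => /incident_pb/andP[_]; rewrite nB.
by have [s -> sE] := fB _ By; rewrite /= sE inE.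
Qed.

End DesignIso.

(** Each edge has one end in [part1 X], so adjacency is the symmetric closure of [adj_incident]. *)
Lemma adjacency_design_bigraph_iso (X : bigraph) (E : design) :
  design_iso (adjacency_design X) E -> bigraph_iso X (incidence_graph E).
Proof.
case=> f [f_bij fP fB fI]; exists f; split=> // x y.
rewrite /= /inc_adj !fI /= /adj_incident (adj_sym x y) -andb_orl.
case xy: (adj y x); rewrite ?andbF ?andbT //.
by case/orP: (adj_part xy) => /andP[yS xS]; rewrite ?xS ?yS ?orbT.
Qed.

(** * Distances in a complete bipartite graph *)

Section Graph.
Variable X : bigraph.

Lemma connected_neighbour (x y : X) :
  connected_graph X -> x != y -> exists z, adj x z.
Proof.
move=> /(_ x y)/connectP[[|z s] /= + ->]; first by rewrite eqxx.
by case/andP=> xz _ _; exists z.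
Qed.

Lemma dist_le n (x y : X) : n < #|X| -> walk n x y -> dist x y <= n.
Proof.
move=> ltnX; apply: contraTleq => lt_n.
by have := before_find 0 lt_n; rewrite nth_iota // add0n => ->.
Qed.

(** Vertices on opposite sides are adjacent, and those on one side are joined by a walk of length 2
    through the other. The bound on [#|X|] places 2 among the lengths that [dist] searches. *)
Lemma complete_diameter : 2 < #|X| ->
    part1 X != set0 -> part2 X != set0 ->
    {in part1 X & part2 X, forall x b, adj x b} -> diameter X <= 2.
Proof.
move=> cardX /set0Pn[x0 Px0] /set0Pn[b0 Bb0] full.
have walk1 (x y : X) : adj x y -> walk 1 x y.
  by move=> xy; apply/existsP; exists [tuple y]; rewrite /= xy eqxx.
have walk2 (x z y : X) : adj x z -> adj z y -> walk 2 x y.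
  by move=> xz zy; apply/existsP; exists [tuple z; y]; rewrite /= xz zy eqxx.
have le1 (x y : X) : walk 1 x y -> dist x y <= 2.
  by move=> xy; apply: leq_trans (dist_le (ltnW cardX) xy) _.
have le2 (x y : X) : walk 2 x y -> dist x y <= 2 by apply: dist_le.
have sides (x : X) : (x \in part1 X) || (x \in part2 X).
  by rewrite -in_setU part_cover.
apply/bigmax_leqP=> x _; apply/bigmax_leqP=> y _.
case/orP: (sides x) => xS; case/orP: (sides y) => yS.
- by apply/le2/(walk2 x b0); rewrite ?(full x) // adj_sym full.
- by apply/le1/walk1/full.
- by apply/le1/walk1; rewrite adj_sym full.
- by apply/le2/(walk2 x x0); rewrite ?(full x0) // adj_sym full.
Qed.

End Graph.

(** * The design is isomorphic to the design of cosets of its block stabilisers *)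

Section NicelyAffineIso.
Local Open Scope group_scope.
Variables (D : design) (G N : {group {perm elem D}}) (x0 : elem D).
Hypothesis nsNG : N <| G.
Hypothesis Gpair : pairwise_transitive G.
Hypothesis Naff : nicely_affine N.
Hypothesis Nreg : regular_on N (points D).
Hypothesis nonempty_blocks : {in blocks D, forall b, exists x, incident x b}.
Hypothesis not_complete : exists x b : elem D, non_incident x b.
Hypothesis x0P : x0 \in points D.
Variable p : nat.
Hypothesis abelN : p.-abelem N.
Hypothesis ntN : N :!=: 1.

Local Notation V := 'rV['F_p]_('dim N).
Local Notation toN := (rVabelem abelN ntN).
Local Notation toV := (abelem_rV abelN ntN).

Let GN n (Nn : n \in N) : n \in G := subsetP (normal_sub nsNG) n Nn.

(** Moved by [n^-1] so as to pass through [x0], the two blocks have the same stabiliser in [N], and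
    [block_stab_inj] applies. There are thus no repeated blocks, as is required for blocks to
    correspond to sets of vectors. *)
Lemma same_points_eq (b c : elem D) : b \in blocks D -> c \in blocks D ->
  (forall x, incident x b = incident x c) -> b = c.
Proof.
move=> Bb Bc Ebc; have [x xb] := nonempty_blocks Bb.
have [n Nn nx0] := moveN0 Nreg x0P (inc_point xb).
have I y d : incident y (n^-1 d) = incident (n y) d.
  by rewrite -(incG Gpair _ _ (GN Nn)) permKV.
apply: (@perm_inj _ n^-1).
have x0b : n^-1 b \in base_blocks x0 by rewrite inE I nx0.
have x0c : n^-1 c \in base_blocks x0 by rewrite inE I nx0 -Ebc.
apply: (block_stab_inj nsNG Gpair Naff Nreg nonempty_blocks not_complete x0P) => //.
apply/group_inj/setP=> m; have [Nm|nNm] := boolP (m \in N).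
  by rewrite (block_stabP nsNG Gpair Naff x0b) // (block_stabP nsNG Gpair Naff x0c) // !I Ebc.
by rewrite !mem_block_stab (negPf nNm).
Qed.

Lemma nicely_affine_design_iso :
  design_iso D (vs_design (vec_family (base_stabs N x0) abelN ntN)).
Proof.
have cNN : abelian N := abelem_abelian abelN.
(* The points of [n b] form a right coset of the stabiliser of [b]; commutativity of [N] makes it
   the left coset used by [coset_by]. *)
have preE b n : b \in base_blocks x0 -> n \in N ->
  point_preimage (fun v : V => toN v x0) (n b) =
    coset_by (vec_set abelN ntN (block_stab N b)) (toV n).
  move=> x0b Nn; rewrite vec_coset abelem_rV_K //; apply/setP=> v; rewrite !inE mem_lcoset.
  have Nv : toN v \in N := mem_rVabelem abelN ntN v.
  have -> : n^-1 * toN v = toN v * n^-1 by apply: (centsP cNN); rewrite ?groupV.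
  rewrite (block_stabP nsNG Gpair Naff x0b) ?groupM ?groupV //.
  by rewrite permM -[RHS](incG Gpair _ _ (GN Nn)) permKV.
apply: (vs_design_iso (psi := fun v : V => toN v x0)).
- move=> v w /(regN Nreg x0P) E; apply: (@rVabelem_inj _ _ _ abelN ntN).
  by apply: E; apply: mem_rVabelem.
- apply/setP=> x; apply/imsetP/idP=> [[v _ ->]|/(moveN0 Nreg x0P)[n Nn <-]].
    have Nv : toN v \in N := mem_rVabelem abelN ntN v.
    by have [-> _ _] := autG Gpair (GN Nv).
  by exists (toV n); rewrite ?inE ?abelem_rV_K.
- move=> b c Bb Bc /setP E; apply: same_points_eq => // x.
  have [Px|nPx] := boolP (x \in points D).
    have [n Nn nx0] := moveN0 Nreg x0P Px.
    by have := E (toV n); rewrite !inE abelem_rV_K // nx0.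
  by apply/idP/idP=> /inc_point; rewrite (negPf nPx).
apply/setP=> S; apply/imsetP/bigcupP=> [[b Bb ->]|[_ /imsetP[_ /imsetP[b x0b ->] ->]]].
  have [n Nn x0nb] := class_through nsNG Gpair Nreg nonempty_blocks x0P Bb.
  have nbP : n b \in base_blocks x0 by rewrite inE.
  exists (vec_set abelN ntN (block_stab N (n b))).
    exact/imset_f/imset_f.
  by rewrite -{1}(permK n b) preE ?groupV // imset_f.
case/imsetP=> v _ ->; exists (toN v b).
  have Nv : toN v \in N := mem_rVabelem abelN ntN v.
  have [_ -> _] := autG Gpair (GN Nv).
  by move: x0b; rewrite inE => /inc_block.
by rewrite preE ?mem_rVabelem // rVabelemK.
Qed.

End NicelyAffineIso.

(** * Application to the adjacency design of the graph *)

Theorem theorem1p8 (X : bigraph) (G N : {group {perm X}}) (r : nat)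
    (Xconn : connected_graph X)
    (GAut : G \subset graph_aut X)
    (Nnontrivial : N :!=: 1%g)
    (Nnormal : (N <| G)%g)
    (r_ge3 : 3 <= r)
    (Xstar : starlike N r)
    (Xldt : locally_distance_transitive G 4)
    (Dpair : pairwise_transitive (D := adjacency_design X) G)
    (Daffine : nicely_affine (D := adjacency_design X) N)
    (Dclasses : #|parallel_classes (D := adjacency_design X) N| = r)
    (Nregular : regular_on N (part1 X)) :
  is_abelem N /\ from_vs_construction X (adjacency_design X) r.
Proof.
pose D := adjacency_design X.
have [x0 Px0] : exists x0, x0 \in part1 X.
  by have [/imsetP[x0 Px0 _] _] := Nregular; exists x0.
have nonempty_blocks : {in blocks D, forall b, exists x, incident x b}.
  move=> b Bb; have nb0 : b != x0.
    apply: contraTneq Bb => ->.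
    by rewrite (points_or_blocks (D := D)) negbK.
  have [z bz] := connected_neighbour Xconn nb0; exists z.
  rewrite /= /adj_incident adj_sym bz andbT.
  move: Bb; rewrite (points_or_blocks (D := D)) => /negPf /= nPb.
  by have := adj_part bz; rewrite nPb /= => /andP[].
have classes_gt2 : 2 < #|parallel_classes (D := D) N| by rewrite Dclasses.
have card2 : 2 < #|part2 X| := leq_trans classes_gt2 (leq_imset_card _ _).
have not_complete : exists x b : elem D, non_incident x b.
  have [/existsP[x /existsP[b xb]]|] := boolP [exists x : elem D, exists b, non_incident x b].
    by exists x, b.
  (* Without a non-incident pair the graph is complete bipartite of diameter at most 2, whereas
     local 4-distance transitivity demands at least 4. *)
  move=> /existsPn full; have [diam _ _] := Xldt.
  suff : diameter X <= 2 by move/(leq_trans diam).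
  apply: complete_diameter.
  - exact: leq_trans card2 (max_card _).
  - by apply/set0Pn; exists x0.
  - by rewrite -card_gt0 ltnW // ltnW.
  move=> x b Px Bb; have /existsPn/(_ b) := full x.
  by rewrite /non_incident Px Bb /= negbK => /andP[].
have fam := base_stabs_family (D := D) Nnormal Dpair Daffine Nregular classes_gt2
  nonempty_blocks not_complete Px0.
have abel := sf_abelem fam; split=> //.
have [p p_pr abelN] := is_abelemP abel.
have /card_gt1P[M1 [M2 [M1Ms M2Ms neM12]]] := sf_card fam.
have cardMs := card_base_stabs (D := D) Nnormal Dpair Daffine Nregular
  nonempty_blocks not_complete Px0.
have Ms_gt2 : 2 < #|base_stabs (D := D) N x0| by rewrite cardMs.
have [Ghat vsc] :=
  vec_conditions fam abelN Nnontrivial p_pr Ms_gt2 M1Ms M2Ms neM12.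
rewrite cardMs Dclasses in vsc.
have iso := nicely_affine_design_iso (D := D) Nnormal Dpair Daffine Nregular
  nonempty_blocks not_complete Px0 abelN Nnontrivial.
do 7![eexists]; split; [exact: vsc | | exact: iso].
exact: adjacency_design_bigraph_iso iso.
Qed.
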